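(* Let $\mu\in(0,1)$, let $M\ge N\ge1$ be integers, $\nu=M-N$, and write $\alpha=\alpha(\mu)$, $\delta=\delta(\mu)$. The correlation kernel $K_N(x,y)$ defined in the context can be written, for $x,y>0$, as $$K_N(x,y)=2\sum_{k,l=0}^{N-1}\sum_{i=0}^l\frac{(-1)^{i+k}(\nu+N+i)!}{(N-1-k)!\,(\nu+k)!\,i!\,(l-i)!\,k!\,(\nu+i)!\,(\nu+k+i+1)}\,\frac{(\alpha^2-\delta^2)^{k+l+\nu+1}}{\alpha^{\nu+l}\delta^k}\,x^{\frac k2}y^{\frac{l+\nu}2}I_k(2\delta\sqrt x)K_{l+\nu}(2\alpha\sqrt y).$$
   Context: For $\mu\in(0,1)$ put $\alpha(\mu)=\frac{1+\mu}{2\mu}$ and $\delta(\mu)=\frac{1-\mu}{2\mu}$, abbreviated $\alpha,\delta$. $I_\kappa$ and $K_\kappa$ are the modified Bessel functions of the first and second kind; $(a)_k=a(a+1)\cdots(a+k-1)$ is the Pochhammer symbol. Define, for $n=0,1,\ldots$, $$P_n(x)=(-1)^n(\nu+n)!\,n!\sum_{k=0}^n\frac{(\alpha^2-\delta^2)^{k+\frac12}}{\delta^k}\frac{(-n)_k}{(\nu+k)!\,k!}\,x^{\frac k2}I_k(2\delta\sqrt x),$$ $$Q_n(y)=(-1)^n\frac{2}{(n!)^2}\sum_{l=0}^n\frac{(\alpha^2-\delta^2)^{l+\nu+\frac12}}{\alpha^{l+\nu}}\frac{(-n)_l}{(\nu+l)!\,l!}\,y^{\frac{l+\nu}2}K_{l+\nu}(2\alpha\sqrt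 y),$$ and $K_N(x,y)=\sum_{n=0}^{N-1}P_n(x)Q_n(y)$. This is the correlation kernel of the determinantal point process formed by the squared singular values of the product $X_1X_2$ of two $\mu$-dependent Gaussian complex random matrices, i.e. an $N\times M$ matrix $X_1$ and an $M\times N$ matrix $X_2$ with joint density $(\pi^2\mu)^{-NM}\exp[-\alpha\operatorname{Tr}(X_1X_1^*+X_2^*X_2)+\delta\operatorname{Tr}(X_1X_2+X_2^*X_1^* )]$. *)

(* Defs.v *)
From HB Require Import structures.
From mathcomp Require Import all_boot all_order all_algebra.
From mathcomp Require Import all_classical all_reals all_analysis.

Set Implicit Arguments.
Unset Strict Implicit.
Unset Printing Implicit Defensive.

Import Order.TTheory GRing.Theory Num.Theory.
Import numFieldNormedType.Exports.

Local Open Scope classical_set_scope.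
Local Open Scope ring_scope.

(* 1 / Gamma(s) as an entire function of s, by Gauss's product
   1 / Gamma(s) = lim_n s (s + 1) ... (s + n) / (n! n^s); it vanishes at the
   poles 0, -1, -2, ... of Gamma. The n = 0 term is irrelevant to the limit. *)
Definition rgamma (R : realType) (s : R) : R :=
  limn (fun n : nat =>
    (\prod_(i < n.+1) (s + i%:R)) / ((n`!)%:R * n%:R `^ s)).

(* I_kappa(z) = sum_m (z/2)^(2m + kappa) / (m! Gamma(m + kappa + 1)), for real
   order kappa and z > 0 (powR is the real power only on positive bases). *)
Definition besselI (R : realType) (kappa z : R) : R :=
  limn (series (fun m : nat =>
    rgamma (m%:R + kappa + 1) / (m`!)%:R * (z / 2) `^ ((2 * m)%:R + kappa))).

(* K_kappa(z) = (pi / 2) (I_(-kappa)(z) - I_kappa(z)) / sin(kappa pi), z > 0.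
   The quotient is 0 / 0 at integer orders, where K_kappa is by definition its
   limit; at the other orders the limit is the value, by continuity. *)
Definition besselK (R : realType) (kappa z : R) : R :=
  lim ((pi / 2 * ((besselI (- t) z - besselI t z) / sin (t * pi)))
         @[t --> kappa^']).

Definition pochhammer (R : realType) (a : R) (k : nat) : R :=
  \prod_(i < k) (a + i%:R).

Definition alpha (R : realType) (mu : R) : R := (1 + mu) / (2 * mu).

Definition delta (R : realType) (mu : R) : R := (1 - mu) / (2 * mu).

Definition P (R : realType) (mu : R) (nu n : nat) (x : R) : R :=
  let a := alpha mu in let d := delta mu in
  (-1) ^+ n * ((nu + n)`!)%:R * (n`!)%:R *
  \sum_(k < n.+1)
    (a ^+ 2 - d ^+ 2) `^ (k%:R + 1 / 2) / d ^+ k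
    * (pochhammer (- n%:R) k / (((nu + k)`!)%:R * (k`!)%:R))
    * x `^ (k%:R / 2) * besselI k%:R (2 * d * Num.sqrt x).

Definition Q (R : realType) (mu : R) (nu n : nat) (y : R) : R :=
  let a := alpha mu in let d := delta mu in
  (-1) ^+ n * (2 / (n`!)%:R ^+ 2) *
  \sum_(l < n.+1)
    (a ^+ 2 - d ^+ 2) `^ ((l + nu)%:R + 1 / 2) / a ^+ (l + nu)
    * (pochhammer (- n%:R) l / (((nu + l)`!)%:R * (l`!)%:R))
    * y `^ ((l + nu)%:R / 2) * besselK (l + nu)%:R (2 * a * Num.sqrt y).

Definition correlation_kernel (R : realType) (mu : R) (nu N : nat) (x y : R)
    : R :=
  \sum_(n < N) P mu nu n x * Q mu nu n y.

(* Main.v *)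
(* The Bessel functions play no role: the two sides are compared coefficientwise
   in I_k K_(l + nu). Since (-n)_k = (-1)^k n (n - 1) ... (n - k + 1), which
   vanishes for n < k, the inner sums can be taken up to N - 1. On the left
   remains a sum over n of (nu + n)! / n! times two falling factorials of n;
   the l-th finite difference identity
     sum_i (-1)^i C(l, i) C(nu + n + i, nu + i) = (-1)^l C(nu + n, nu + l)
   trades one of them for a sum over i of terms (nu + n + i)!, after which the
   sum over n is a hockey-stick sum; it produces the factor
   1 / (nu + k + i + 1). *)
Require Import Defs.
From HB Require Import structures.
From mathcomp Require Import all_boot all_order all_algebra.
From mathcomp Require Import all_classical all_reals all_analysis.
From mathcomp Require Import ring.

Set Implicit Arguments.
Unset Strict Implicit.
Unset Printing Implicit Defensive.

Import Order.TTheory GRing.Theory Num.Theory.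
Import numFieldNormedType.Exports.

Local Open Scope ring_scope.

Lemma pochhammer_oppn (R : realType) (n k : nat) :
  pochhammer (- n%:R : R) k = (-1) ^+ k * (n ^_ k)%:R.
Proof.
rewrite /pochhammer; elim: k => [|k IHk]; first by rewrite big_ord0 mul1r.
rewrite big_ord_recr /= IHk ffactnSr exprS natrM.
case: (leqP k n) => [le_kn|lt_nk]; first by rewrite natrB //; ring.
by rewrite ffact_small // !(mulr0, mul0r).
Qed.

(** Pascal's rule splits ['C(l.+1, i)]; an index shift in one of the two halves gathers the
    differences. *)
Lemma sum_sign_binS (R : comPzRingType) (l : nat) (f : nat -> R) :
  \sum_(i < l.+2) (-1) ^+ i * 'C(l.+1, i)%:R * f i
  = \sum_(i < l.+1) (-1) ^+ i * 'C(l, i)%:R * (f i - f i.+1).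
Proof.
rewrite big_ord_recl /=.
under eq_bigr => i _ do rewrite /bump /= add1n binS natrD mulrDr mulrDl.
under [RHS]eq_bigr => i _ do rewrite mulrBr.
rewrite big_split sumrB /= addrA; congr (_ + _).
  rewrite big_ord_recr /= (@bin_small l l.+1) // mulr0 mul0r addr0.
  by rewrite [RHS]big_ord_recl !bin0.
by rewrite -sumrN; apply: eq_bigr => i _; rewrite exprS; ring.
Qed.

(** Induction on [l] for all [m] and [r]: one differencing leaves the instances (m, r) and (m + 1, r
    + 1), and C(m, r + l) - C(m + 1, r + l + 1) = -C(m, r + l + 1) by Pascal's rule. *)
Lemma sum_sign_bin_bin (R : comPzRingType) (l m r : nat) :
  \sum_(i < l.+1) (-1) ^+ i * 'C(l, i)%:R * 'C(m + i, r + i)%:R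
  = (-1) ^+ l * 'C(m, r + l)%:R :> R.
Proof.
elim: l m r => [|l IHl] m r; first by rewrite big_ord1 bin0 mulr1 !addn0.
rewrite (sum_sign_binS _ (fun i => 'C(m + i, r + i)%:R)).
under eq_bigr => i _ do rewrite -!addSnnS mulrBr.
by rewrite sumrB !IHl addSn binS natrD addnS exprS; ring.
Qed.

Lemma natr_fact_neq0 (F : numDomainType) (n : nat) : (n`!)%:R != 0 :> F.
Proof. by rewrite pnatr_eq0 -lt0n fact_gt0. Qed.

(** For n >= k the summand is (r + k)! C(r + n, r + k), so this is the hockey-stick identity in
    factorial form. *)
Lemma sum_fact_ffact (F : numFieldType) (r k N : nat) :
  \sum_(n < N) ((r + n)`!)%:R * (n ^_ k)%:R / (n`!)%:R
  = ((r + N)`!)%:R * (N ^_ k.+1)%:R / ((N`!)%:R * (r + k + 1)%:R) :> F.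
Proof.
elim: N => [|N IHN]; first by rewrite big_ord0 ffact0n mulr0 mul0r.
rewrite big_ord_recr /= IHN (addnS r N) ffactSS ffactnSr !factS !natrM addn1.
(* The truncated [N - k] is a true difference only for k <= N; otherwise both sides vanish. *)
have [le_kN|lt_Nk] := leqP k N; last first.
  by rewrite ffact_small // !(mulr0, mul0r) addr0.
have N_neq0 : N.+1%:R != 0 :> F by rewrite pnatr_eq0.
have rk_neq0 : (r + k).+1%:R != 0 :> F by rewrite pnatr_eq0.
have fact_neq0 := natr_fact_neq0 F N.
move: N_neq0 rk_neq0; rewrite natrB // -!natr1 !natrD => N_neq0 rk_neq0.
by field; rewrite N_neq0 rk_neq0 fact_neq0.
Qed.

(** The left side is n! / l! times (-1)^l C(nu + n, nu + l), which [sum_sign_bin_bin] expands with m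
    = nu + n and r = nu. *)
Lemma fact_ffact_expansion (F : numFieldType) (nu n l : nat) :
  (-1) ^+ l * ((nu + n)`!)%:R * (n ^_ l)%:R / (((nu + l)`!)%:R * (l`!)%:R)
  = \sum_(i < l.+1) (-1) ^+ i * ((nu + n + i)`!)%:R
      / ((i`!)%:R * ((l - i)`!)%:R * ((nu + i)`!)%:R) :> F.
Proof.
have fact_neq0 := natr_fact_neq0 F.
have ffactE : ((nu + n)`!)%:R * (n ^_ l)%:R
    = 'C(nu + n, nu + l)%:R * (n`!)%:R * ((nu + l)`!)%:R :> F.
  rewrite -!natrM; congr _%:R.
  have [le_ln|lt_nl] := leqP l n.
    rewrite -(ffact_fact le_ln) -(bin_fact (leq_add (leqnn nu) le_ln)) subnDl.
    by ring.
  by rewrite ffact_small // bin_small ?ltn_add2l // !mul0n muln0.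
transitivity ((n`!)%:R / (l`!)%:R * ((-1) ^+ l * 'C(nu + n, nu + l)%:R) : F).
  rewrite -mulrA [in LHS]mulrA -[_ * _ * (n ^_ l)%:R]mulrA ffactE.
  by field; rewrite !fact_neq0.
rewrite -sum_sign_bin_bin mulr_sumr; apply: eq_bigr => i _.
have le_il : (i <= l)%N by rewrite -ltnS.
rewrite -(bin_fact le_il).
have -> : ((nu + n + i)`!)%:R
    = 'C(nu + n + i, nu + i)%:R * ((nu + i)`!)%:R * (n`!)%:R :> F.
  have le_i : (nu + i <= nu + n + i)%N by rewrite leq_add2r leq_addr.
  rewrite -(bin_fact le_i) addnAC addKn -!natrM.
  by congr _%:R; ring.
rewrite !natrM; have : 'C(l, i)%:R != 0 :> F by rewrite pnatr_eq0 -lt0n bin_gt0.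
by move=> bin_neq0; field; rewrite bin_neq0 !fact_neq0.
Qed.

(** Only [n ^_ l] is expanded; [n ^_ k] is kept, so that for each [i] the sum over [n] is
    [sum_fact_ffact] with r = nu + i. *)
Lemma kernel_coefficient (F : numFieldType) (nu N k l : nat) : (k < N)%N ->
  \sum_(n < N) ((nu + n)`!)%:R / (n`!)%:R
    * ((-1) ^+ k * (n ^_ k)%:R / (((nu + k)`!)%:R * (k`!)%:R))
    * ((-1) ^+ l * (n ^_ l)%:R / (((nu + l)`!)%:R * (l`!)%:R))
  = \sum_(i < l.+1) (-1) ^+ (i + k) * ((nu + N + i)`!)%:R /
       (((N - 1 - k)`!)%:R * ((nu + k)`!)%:R * (i`!)%:R * ((l - i)`!)%:R
        * (k`!)%:R * ((nu + i)`!)%:R * (nu + k + i + 1)%:R) :> F.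
Proof.
move=> lt_kN; have fact_neq0 := natr_fact_neq0 F.
transitivity (\sum_(n < N) \sum_(i < l.+1)
    (-1) ^+ (i + k) / (((nu + k)`!)%:R * (k`!)%:R
       * ((i`!)%:R * ((l - i)`!)%:R * ((nu + i)`!)%:R))
    * (((nu + i + n)`!)%:R * (n ^_ k)%:R / (n`!)%:R) : F).
  apply: eq_bigr => n _.
  transitivity ((-1) ^+ k * (n ^_ k)%:R / (((nu + k)`!)%:R * (k`!)%:R)
    / (n`!)%:R * ((-1) ^+ l * ((nu + n)`!)%:R * (n ^_ l)%:R
      / (((nu + l)`!)%:R * (l`!)%:R)) : F).
    by field; rewrite !fact_neq0.
  rewrite fact_ffact_expansion mulr_sumr; apply: eq_bigr => i _.
  by rewrite (addnAC nu i n) exprD; field; rewrite !fact_neq0.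
rewrite exchange_big; apply: eq_bigr => i _.
rewrite -mulr_sumr sum_fact_ffact (addnAC nu i N) (addnAC nu i k).
(* As k < N, N! = N^_(k+1) (N - 1 - k)!, which cancels the falling factorial. *)
rewrite -subnDA add1n -(ffact_fact lt_kN) natrM.
have ffact_neq0 : (N ^_ k.+1)%:R != 0 :> F.
  by rewrite pnatr_eq0 -lt0n ffact_gt0.
have nat_neq0 : (nu + k + i + 1)%:R != 0 :> F by rewrite addn1 pnatr_eq0.
rewrite !natrD in nat_neq0 *.
by field; rewrite ffact_neq0 nat_neq0 !fact_neq0.
Qed.

Lemma sum_ord_widen_small (V : nmodType) (n N : nat) (f : nat -> V) :
  (n < N)%N -> (forall k, (n < k)%N -> f k = 0) ->
  \sum_(k < n.+1) f k = \sum_(k < N) f k.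
Proof.
move=> lt_nN f0; rewrite (big_ord_widen N f lt_nN) big_mkcond /=.
by apply: eq_bigr => k _; rewrite ltnS; case: leqP => // /f0 ->.
Qed.

Theorem theorem3p3 (R : realType) (mu : R) (M N : nat)
    (hmu0 : 0 < mu) (hmu1 : mu < 1) (hNM : (N <= M)%N) (hN : (1 <= N)%N)
    (x y : R) (hx : 0 < x) (hy : 0 < y) :
  let nu := (M - N)%N in
  let a := alpha mu in
  let d := delta mu in
  correlation_kernel mu nu N x y =
  2 * \sum_(k < N) \sum_(l < N) \sum_(i < l.+1)
    ((-1) ^+ (i + k) * ((nu + N + i)`!)%:R /
       (((N - 1 - k)`!)%:R * ((nu + k)`!)%:R * (i`!)%:R * ((l - i)`!)%:R
        * (k`!)%:R * ((nu + i)`!)%:R * (nu + k + i + 1)%:R)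
     * ((a ^+ 2 - d ^+ 2) ^+ (k + l + nu + 1) / (a ^+ (nu + l) * d ^+ k))
     * x `^ (k%:R / 2) * y `^ ((l + nu)%:R / 2)
     * besselI k%:R (2 * d * Num.sqrt x)
     * besselK (l + nu)%:R (2 * a * Num.sqrt y)).
Proof.
move=> nu a d.
have c_gt0 : 0 < a ^+ 2 - d ^+ 2.
  (* Here alpha + delta = 1 / mu and alpha - delta = 1. *)
  have -> : a ^+ 2 - d ^+ 2 = mu^-1.
    by rewrite /a /d /alpha /delta; field; rewrite gt_eqF.
  by rewrite invr_gt0.
set c := a ^+ 2 - d ^+ 2 in c_gt0 *.
(* The halves in the exponents of [P] and [Q] add up to the final 1. *)
have powR_half k l : c `^ (k%:R + 1 / 2) * c `^ ((l + nu)%:R + 1 / 2)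
    = c ^+ (k + l + nu + 1).
  rewrite -powRD; last by rewrite (gt_eqF c_gt0) implybT.
  rewrite -powR_mulrn ?ltW //; congr (_ `^ _).
  by rewrite !natrD; field.
(* [u] and [v] hold the Bessel factors as opaque quantities; [p] is the rational coefficient shared
   by [P] and [Q]. *)
pose u k := x `^ (k%:R / 2) * besselI k%:R (2 * d * Num.sqrt x) / d ^+ k.
pose v l := y `^ ((l + nu)%:R / 2) * besselK (l + nu)%:R (2 * a * Num.sqrt y)
  / a ^+ (l + nu).
pose p n k : R := (-1) ^+ k * (n ^_ k)%:R / (((nu + k)`!)%:R * (k`!)%:R).
have PE (n : 'I_N) : P mu nu n x = (-1) ^+ n * ((nu + n)`!)%:R * (n`!)%:R
    * \sum_(k < N) c `^ (k%:R + 1 / 2) * p n k * u k.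
  rewrite /P -/a -/d -/c -(@sum_ord_widen_small _ n N
    (fun k => c `^ (k%:R + 1 / 2) * p n k * u k)) //.
    congr (_ * _); apply: eq_bigr => k _.
    by rewrite pochhammer_oppn /u /p; ring.
  by move=> k lt_nk; rewrite /p ffact_small // !(mulr0, mul0r).
have QE (n : 'I_N) : Q mu nu n y = (-1) ^+ n * (2 / (n`!)%:R ^+ 2)
    * \sum_(l < N) c `^ ((l + nu)%:R + 1 / 2) * p n l * v l.
  rewrite /Q -/a -/d -/c -(@sum_ord_widen_small _ n N
    (fun l => c `^ ((l + nu)%:R + 1 / 2) * p n l * v l)) //.
    congr (_ * _); apply: eq_bigr => l _.
    by rewrite pochhammer_oppn /v /p; ring.
  by move=> l lt_nl; rewrite /p ffact_small // !(mulr0, mul0r).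
(* The prefactors (nu + n)! n! and 2 / (n!)^2 combine to 2 (nu + n)! / n!. *)
transitivity (2 * \sum_(k < N) \sum_(l < N) c ^+ (k + l + nu + 1) * u k * v l
    * \sum_(n < N) ((nu + n)`!)%:R / (n`!)%:R * p n k * p n l).
  rewrite /correlation_kernel.
  under [in RHS]eq_bigr => k _ do under eq_bigr => l _ do rewrite mulr_sumr.
  under [in RHS]eq_bigr => k _ do rewrite exchange_big.
  rewrite [in RHS]exchange_big mulr_sumr; apply: eq_bigr => n _.
  rewrite PE QE mulrACA mulr_suml !mulr_sumr; apply: eq_bigr => k _.
  rewrite !mulr_sumr; apply: eq_bigr => l _; rewrite -powR_half.
  have fact_neq0 := natr_fact_neq0 R n.
  (* The signs (-1)^n of [P] and [Q] are matched by writing 1 as their square. *)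
  by rewrite -[RHS]mul1r -[X in _ = X * _](sqrr_sign R n); field.
congr (_ * _); apply: eq_bigr => k _; apply: eq_bigr => l _.
rewrite /p kernel_coefficient // mulr_sumr; apply: eq_bigr => i _.
by rewrite /u /v (addnC nu l) [(a ^+ _ * _)^-1]invfM; ring.
Qed.
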